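(* The quotient $\theta[1;\tfrac15]/\theta[1;\tfrac35]$ is given by a rational expression of four of the theta constants $\theta[\tfrac15;\tfrac k5]$, where $k=1,3,5,7,9$.
   Context: Let $\mathbb{H}^2=\{\tau\in\mathbb{C}:\Im\tau>0\}$. For $(\epsilon,\epsilon')\in\mathbb{R}^2$, $$\theta[\epsilon;\epsilon'](\zeta,\tau)=\sum_{n\in\mathbb{Z}}\exp\Big(2\pi i\Big[\tfrac12\big(n+\tfrac{\epsilon}{2}\big)^2\tau+\big(n+\tfrac{\epsilon}{2}\big)\big(\zeta+\tfrac{\epsilon'}{2}\big)\Big]\Big),$$ and the theta constant $\theta[\epsilon;\epsilon']=\theta[\epsilon;\epsilon'](0,\tau)$ is regarded as a holomorphic function of $\tau\in\mathbb{H}^2$. Rational expressions are with complex coefficients (involving $\zeta_5=e^{2\pi i/5}$), as identities of functions of $\tau$. *)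

(* Defs.v *)
From Stdlib Require Import Reals List.
From Coquelicot Require Import Coquelicot.
Open Scope R_scope.

Definition cexp (z : C) : C :=
  (exp (Re z) * cos (Im z), exp (Re z) * sin (Im z)).

(* Sum of a series of complex numbers, via the (Coquelicot) sums of its real
   and imaginary parts.  Meaningful when the series converges (here it
   converges absolutely). *)
Definition CSeries (a : nat -> C) : C :=
  (Series (fun n => Re (a n)), Series (fun n => Im (a n))).

Definition CSeriesZ (f : Z -> C) : C :=
  Cplus (CSeries (fun n => f (Z.of_nat n)))
        (CSeries (fun m => f (Z.opp (Z.of_nat (S m))))).

Definition theta (eps eps' : R) (zeta tau : C) : C :=
  CSeriesZ (fun n =>
    let a : R := IZR n + eps / 2 in
    cexp (Cmult (Cmult (RtoC 2) (Cmult (RtoC PI) Ci))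
      (Cplus (Cmult (RtoC (a * a / 2)) tau)
             (Cmult (RtoC a) (Cplus zeta (RtoC (eps' / 2))))))).

Definition theta_const (eps eps' : R) (tau : C) : C :=
  theta eps eps' (RtoC 0) tau.

Definition in_H2 (tau : C) : Prop := Im tau > 0.

(* Polynomials in 4 variables with complex coefficients, as finite lists of
   (coefficient, exponent vector) monomials, and their evaluation. *)
Definition poly4 := list (C * (nat * nat * nat * nat)).

Definition eval4 (p : poly4) (x1 x2 x3 x4 : C) : C :=
  fold_right (fun m acc =>
    match m with
    | (c, (e1, e2, e3, e4)) =>
        Cplus (Cmult c (Cmult (Cmult (Cpow x1 e1) (Cpow x2 e2))
                              (Cmult (Cpow x3 e3) (Cpow x4 e4)))) acc
    end) (RtoC 0) p.

Definition theta5 (k : nat) (tau : C) : C :=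
  theta_const (1 / 5) (INR k / 5) tau.

(* Main.v *)
(* Write e_k = theta[1/5; k/5], A_j = theta[1; j/5].  Splitting a product of two
   theta series according to the parity of the sum of the summation indices gives
   e_{x+y-5} A_{x-y+5} = c * det (v_x, v_y) for vectors v_x in C^2 made of theta
   constants at 2 tau.  The Pluecker relations among v_1, v_3, v_5, v_7, v_9 become
   relations between the e_k, A_1 and A_3; eliminating e_5 from them in two ways
   yields A_1 X = 0 and A_3 X = 0, where
     X = (e_3^2 e_9 - e_1 e_7^2) A_1 - (l e_1^2 e_3 - l^-1 e_7 e_9^2) A_3,
     l = exp (pi i / 5).
   Hence X = 0, trivially so where A_1 = A_3 = 0.  The coefficient of A_1 does not
   vanish identically, by its q-expansion on the imaginary axis. *)
Require Import Defs.
From Stdlib Require Import Reals ZArith List Permutation ClassicalEpsilon Lra Lia.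
From Coquelicot Require Import Coquelicot.
Open Scope R_scope.

(** * Unconditional sums over an arbitrary index type *)

Definition lsum {I : Type} (f : I -> C) (L : list I) : C :=
  fold_right (fun i s => Cplus (f i) s) (RtoC 0) L.

Definition labs {I : Type} (f : I -> C) (L : list I) : R :=
  fold_right (fun i s => Cmod (f i) + s) 0 L.

(** Convergence along the finite subsets of [I], encoded as duplicate-free lists directed by
    inclusion. No order on [I] enters, so sums can be transported along bijections and taken over
    pairs. *)
Definition has_sum {I : Type} (f : I -> C) (l : C) : Prop :=
  forall eps, 0 < eps -> exists L0, forall L, NoDup L -> incl L0 L ->
    Cmod (Cminus (lsum f L) l) < eps.

(** The Cauchy criterion for the family of norms: it needs no name for the sum of the norms. *)
Definition abs_summable {I : Type} (f : I -> C) : Prop :=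
  forall eps, 0 < eps -> exists L0, forall L, NoDup L ->
    (forall i, In i L -> ~ In i L0) -> labs f L < eps.

(** Excluded middle decides equality on an arbitrary index type, so that membership in a finite list
    can serve as a filter. *)
Definition classical_eq_dec {I : Type} (x y : I) : {x = y} + {x <> y} :=
  excluded_middle_informative (x = y).

Definition outside {I : Type} (L0 L : list I) : list I :=
  filter (fun i => if in_dec classical_eq_dec i L0 then false else true) L.

Lemma in_outside {I : Type} (L0 L : list I) (i : I) :
  In i (outside L0 L) <-> In i L /\ ~ In i L0.
Proof.
  unfold outside; rewrite filter_In.
  destruct (in_dec classical_eq_dec i L0); intuition congruence.
Qed.

Lemma NoDup_outside {I : Type} (L0 L : list I) : NoDup L -> NoDup (outside L0 L).
Proof. apply NoDup_filter. Qed.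

Lemma lsum_app {I : Type} (f : I -> C) (L L' : list I) :
  lsum f (L ++ L') = Cplus (lsum f L) (lsum f L').
Proof.
  induction L as [|i L IH]; simpl.
  - now rewrite Cplus_0_l.
  - now rewrite IH, Cplus_assoc.
Qed.

Lemma labs_app {I : Type} (f : I -> C) (L L' : list I) :
  labs f (L ++ L') = labs f L + labs f L'.
Proof. induction L as [|i L IH]; simpl; [|rewrite IH]; lra. Qed.

Lemma lsum_map {I J : Type} (f : I -> C) (phi : J -> I) (L : list J) :
  lsum f (map phi L) = lsum (fun j => f (phi j)) L.
Proof. induction L as [|j L IH]; simpl; [|rewrite IH]; reflexivity. Qed.

Lemma labs_map {I J : Type} (f : I -> C) (phi : J -> I) (L : list J) :
  labs f (map phi L) = labs (fun j => f (phi j)) L.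
Proof. induction L as [|j L IH]; simpl; [|rewrite IH]; reflexivity. Qed.

Lemma lsum_perm {I : Type} (f : I -> C) (L L' : list I) :
  Permutation L L' -> lsum f L = lsum f L'.
Proof.
  induction 1; simpl; try congruence.
  rewrite !Cplus_assoc; f_equal; apply Cplus_comm.
Qed.

Lemma labs_nonneg {I : Type} (f : I -> C) (L : list I) : 0 <= labs f L.
Proof.
  induction L as [|i L IH]; simpl; [lra|]; pose proof (Cmod_ge_0 (f i)); lra.
Qed.

Lemma Cmod_lsum {I : Type} (f : I -> C) (L : list I) : Cmod (lsum f L) <= labs f L.
Proof.
  induction L as [|i L IH]; simpl.
  - rewrite Cmod_0; lra.
  - pose proof (Cmod_triangle (f i) (lsum f L)); lra.
Qed.

(** Each head of [L] is cut out of [L']; since it does not recur in [L], the rest of [L] still lies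
    in what remains. *)
Lemma labs_incl {I : Type} (f : I -> C) (L L' : list I) :
  NoDup L -> incl L L' -> labs f L <= labs f L'.
Proof.
  revert L'; induction L as [|i L IH]; intros L' ND Hincl; simpl.
  - apply labs_nonneg.
  - inversion ND as [|? ? Hi ND']; subst.
    destruct (in_split i L' (Hincl i (or_introl eq_refl))) as (A & B & ->).
    assert (H : incl L (A ++ B)).
    { intros j Hj; specialize (Hincl j (or_intror Hj)).
      rewrite in_app_iff in *; simpl in Hincl.
      destruct Hincl as [?|[<-|?]]; tauto. }
    specialize (IH _ ND' H); rewrite labs_app in *; simpl; lra.
Qed.

Lemma lsum_split {I : Type} (f : I -> C) (L0 L : list I) :
  NoDup L0 -> NoDup L -> incl L0 L ->
  lsum f L = Cplus (lsum f L0) (lsum f (outside L0 L)).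
Proof.
  intros ND0 ND Hincl; rewrite <- lsum_app; apply lsum_perm.
  apply NoDup_Permutation; auto.
  - apply NoDup_app; auto using NoDup_outside.
    intros i Hi Hi'; apply in_outside in Hi'; tauto.
  - intros i; rewrite in_app_iff, in_outside.
    destruct (in_dec classical_eq_dec i L0); intuition.
Qed.

Lemma lsum_list_prod {I J : Type} (f : I -> C) (g : J -> C) (L : list I) (M : list J) :
  lsum (fun p => Cmult (f (fst p)) (g (snd p))) (list_prod L M)
  = Cmult (lsum f L) (lsum g M).
Proof.
  induction L as [|i L IH]; simpl; [ring|].
  rewrite lsum_app, IH, lsum_map, Cmult_plus_distr_r; f_equal; simpl.
  clear; induction M as [|j M IH]; simpl; [|rewrite IH]; ring.
Qed.

Lemma labs_list_prod {I J : Type} (f : I -> C) (g : J -> C) (L : list I) (M : list J) :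
  labs (fun p => Cmult (f (fst p)) (g (snd p))) (list_prod L M) = labs f L * labs g M.
Proof.
  induction L as [|i L IH]; simpl; [ring|].
  rewrite labs_app, IH, labs_map, Rmult_plus_distr_r; f_equal; simpl.
  clear; induction M as [|j M IH]; simpl; [|rewrite IH, Cmod_mult]; ring.
Qed.

Lemma NoDup_list_prod {I J : Type} (L : list I) (M : list J) :
  NoDup L -> NoDup M -> NoDup (list_prod L M).
Proof.
  intros NL NM; induction NL as [|i L Hi NL IH]; simpl; [constructor|].
  apply NoDup_app; auto.
  - apply FinFun.Injective_map_NoDup; auto; intros x y E; congruence.
  - intros [a b] H H'; apply in_map_iff in H as (y & E & _); injection E as <- <-.
    apply in_prod_iff in H'; tauto.
Qed.

Lemma has_sum_ext {I : Type} (f g : I -> C) (l : C) :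
  (forall i, f i = g i) -> has_sum f l -> has_sum g l.
Proof.
  intros E H eps He; destruct (H eps He) as (L0 & HL); exists L0; intros L ND Hi.
  replace (lsum g L) with (lsum f L); auto.
  clear -E; induction L as [|i L IH]; simpl; [|rewrite IH, E]; reflexivity.
Qed.

(** A finite set containing both witnesses would have a sum closer to each limit than half their
    distance. *)
Lemma has_sum_unique {I : Type} (f : I -> C) (l l' : C) :
  has_sum f l -> has_sum f l' -> l = l'.
Proof.
  intros H H'; destruct (Ceq_dec l l') as [|Hne]; auto; exfalso.
  assert (Hd : 0 < Cmod (Cminus l l')).
  { apply Cmod_gt_0; intros E; apply Hne.
    replace l with (Cplus (Cminus l l') l') by ring; rewrite E; ring. }
  destruct (H (Cmod (Cminus l l') / 2)) as (L0 & HL); [lra|].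
  destruct (H' (Cmod (Cminus l l') / 2)) as (L0' & HL'); [lra|].
  set (L := nodup classical_eq_dec (L0 ++ L0')).
  assert (ND : NoDup L) by apply NoDup_nodup.
  specialize (HL L ND); specialize (HL' L ND).
  assert (Cmod (Cminus l l')
          <= Cmod (Cminus (lsum f L) l) + Cmod (Cminus (lsum f L) l')).
  { rewrite <- (Cmod_opp (Cminus (lsum f L) l)).
    replace (Cminus l l')
      with (Cplus (Copp (Cminus (lsum f L) l)) (Cminus (lsum f L) l')) by ring.
    apply Cmod_triangle. }
  assert (incl L0 L) by (intros i Hi; apply nodup_In, in_app_iff; auto).
  assert (incl L0' L) by (intros i Hi; apply nodup_In, in_app_iff; auto).
  specialize (HL ltac:(auto)); specialize (HL' ltac:(auto)); lra.
Qed.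

Lemma has_sum_reindex {I J : Type} (phi : J -> I) (psi : I -> J) (f : I -> C) (l : C) :
  (forall j, psi (phi j) = j) -> (forall i, phi (psi i) = i) ->
  has_sum f l -> has_sum (fun j => f (phi j)) l.
Proof.
  intros Hj Hi H eps He; destruct (H eps He) as (L0 & HL).
  exists (map psi L0); intros L ND Hincl; rewrite <- lsum_map; apply HL.
  - apply FinFun.Injective_map_NoDup; auto.
    intros x y E; rewrite <- (Hj x), <- (Hj y), E; auto.
  - intros i Hin; rewrite <- (Hi i); apply in_map, Hincl, in_map, Hin.
Qed.

Lemma has_sum_scal {I : Type} (c : C) (f : I -> C) (l : C) :
  has_sum f l -> has_sum (fun i => Cmult c (f i)) (Cmult c l).
Proof.
  intros H eps He; pose proof (Cmod_ge_0 c) as Hc.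
  (* The added 1 covers [c = 0]. *)
  destruct (H (eps / (Cmod c + 1))) as (L0 & HL).
  { apply Rdiv_lt_0_compat; lra. }
  exists L0; intros L ND Hincl; specialize (HL L ND Hincl).
  assert (E : lsum (fun i => Cmult c (f i)) L = Cmult c (lsum f L)).
  { clear; induction L as [|i L IH]; simpl; [|rewrite IH]; ring. }
  rewrite E; replace (Cminus (Cmult c (lsum f L)) (Cmult c l))
    with (Cmult c (Cminus (lsum f L) l)) by ring.
  rewrite Cmod_mult; pose proof (Cmod_ge_0 (Cminus (lsum f L) l)).
  apply Rle_lt_trans with ((Cmod c + 1) * Cmod (Cminus (lsum f L) l)); [nra|].
  apply Rlt_le_trans with ((Cmod c + 1) * (eps / (Cmod c + 1))).
  - apply Rmult_lt_compat_l; lra.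
  - right; field; lra.
Qed.

(** * Sums over disjoint unions and over products *)

Fixpoint lefts {I J : Type} (L : list (I + J)) : list I :=
  match L with
  | nil => nil
  | inl i :: L => i :: lefts L
  | inr _ :: L => lefts L
  end.

Fixpoint rights {I J : Type} (L : list (I + J)) : list J :=
  match L with
  | nil => nil
  | inl _ :: L => rights L
  | inr j :: L => j :: rights L
  end.

Lemma in_lefts {I J : Type} (L : list (I + J)) (i : I) : In i (lefts L) <-> In (inl i) L.
Proof.
  induction L as [|[k|k] L IH]; simpl; [tauto| |]; rewrite IH.
  - split; intros [E|H]; auto; left; congruence.
  - split; [tauto|]; intros [E|H]; [discriminate|auto].
Qed.

Lemma in_rights {I J : Type} (L : list (I + J)) (j : J) : In j (rights L) <-> In (inr j) L.
Proof.
  induction L as [|[k|k] L IH]; simpl; [tauto| |]; rewrite IH.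
  - split; [tauto|]; intros [E|H]; [discriminate|auto].
  - split; intros [E|H]; auto; left; congruence.
Qed.

Lemma NoDup_lefts_rights {I J : Type} (L : list (I + J)) :
  NoDup L -> NoDup (lefts L) /\ NoDup (rights L).
Proof.
  induction 1 as [|[k|k] L Hk ND [IHl IHr]]; simpl; split; auto; constructor; auto.
  - now rewrite in_lefts.
  - now rewrite in_rights.
Qed.

(** A finite subset of a disjoint union splits into its two traces, each approximating its own sum
    within [eps / 2]. *)
Lemma has_sum_disjoint_union {I J : Type} (f : I + J -> C) (a b : C) :
  has_sum (fun i => f (inl i)) a -> has_sum (fun j => f (inr j)) b ->
  has_sum f (Cplus a b).
Proof.
  intros Ha Hb eps He.
  destruct (Ha (eps / 2)) as (A & HA); [lra|].
  destruct (Hb (eps / 2)) as (B & HB); [lra|].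
  exists (map inl A ++ map inr B); intros L ND Hincl.
  destruct (NoDup_lefts_rights L ND) as [NDl NDr].
  specialize (HA (lefts L) NDl); specialize (HB (rights L) NDr).
  assert (E : lsum f L = Cplus (lsum (fun i => f (inl i)) (lefts L))
                               (lsum (fun j => f (inr j)) (rights L))).
  { clear; induction L as [|[k|k] L IH]; simpl; [|rewrite IH|rewrite IH]; ring. }
  rewrite E.
  match goal with |- Cmod (Cminus (Cplus ?x ?y) _) < _ =>
    replace (Cminus (Cplus x y) (Cplus a b))
      with (Cplus (Cminus x a) (Cminus y b)) by ring end.
  eapply Rle_lt_trans; [apply Cmod_triangle|].
  assert (incl A (lefts L)).
  { intros i Hi; apply in_lefts, Hincl, in_app_iff; left; now apply in_map. }
  assert (incl B (rights L)).
  { intros i Hi; apply in_rights, Hincl, in_app_iff; right; now apply in_map. }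
  specialize (HA ltac:(auto)); specialize (HB ltac:(auto)); lra.
Qed.

Lemma abs_summable_bounded {I : Type} (f : I -> C) :
  abs_summable f -> exists M, 0 <= M /\ forall L, NoDup L -> labs f L <= M.
Proof.
  intros H; destruct (H 1 Rlt_0_1) as (L0 & HL).
  exists (labs f L0 + 1); split; [pose proof (labs_nonneg f L0); lra|].
  intros L ND.
  specialize (HL (outside L0 L) (NoDup_outside L0 L ND)).
  assert (labs f L <= labs f (L0 ++ outside L0 L)).
  { apply labs_incl; auto; intros i Hi; rewrite in_app_iff, in_outside.
    destruct (in_dec classical_eq_dec i L0); auto. }
  rewrite labs_app in *.
  specialize (HL ltac:(intros i Hi; now apply in_outside in Hi)); lra.
Qed.

(** Over a finite rectangle [A] x [B] the sum factors. A larger finite set of pairs adds only pairs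
    with an entry outside [A] or outside [B], and absolute summability makes their total mass
    small. *)
Lemma has_sum_mult {I J : Type} (f : I -> C) (g : J -> C) (a b : C) :
  abs_summable f -> abs_summable g -> has_sum f a -> has_sum g b ->
  has_sum (fun p => Cmult (f (fst p)) (g (snd p))) (Cmult a b).
Proof.
  intros Sf Sg Ha Hb eps He.
  destruct (abs_summable_bounded f Sf) as (M & HM0 & HM).
  destruct (abs_summable_bounded g Sg) as (N & HN0 & HN).
  pose proof (Cmod_ge_0 b) as Hb0.
  (* [K] collects four errors: [d * N] and [M * d] outside the rectangle, [M * d] and [d * Cmod b]
     inside it. The 1 keeps [K] positive. *)
  set (K := 2 * M + N + Cmod b + 1).
  set (d := eps / K).
  assert (HK : 0 < K) by (unfold K; lra).
  assert (Hd : 0 < d) by (apply Rdiv_lt_0_compat; lra).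
  assert (HdK : d * K = eps) by (unfold d; field; lra).
  destruct (Sf d Hd) as (A1 & HA1), (Ha d Hd) as (A2 & HA2).
  destruct (Sg d Hd) as (B1 & HB1), (Hb d Hd) as (B2 & HB2).
  set (A := nodup classical_eq_dec (A1 ++ A2)); set (B := nodup classical_eq_dec (B1 ++ B2)).
  assert (NA : NoDup A) by apply NoDup_nodup.
  assert (NB : NoDup B) by apply NoDup_nodup.
  assert (IA1 : incl A1 A) by (intros i Hi; apply nodup_In, in_app_iff; auto).
  assert (IA2 : incl A2 A) by (intros i Hi; apply nodup_In, in_app_iff; auto).
  assert (IB1 : incl B1 B) by (intros i Hi; apply nodup_In, in_app_iff; auto).
  assert (IB2 : incl B2 B) by (intros i Hi; apply nodup_In, in_app_iff; auto).
  exists (list_prod A B); intros L ND Hincl.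
  set (F := fun p : I * J => Cmult (f (fst p)) (g (snd p))).
  rewrite (lsum_split F (list_prod A B) L) by auto using NoDup_list_prod.
  unfold F at 1; rewrite lsum_list_prod.
  (* [P] and [R] are the projections of [L]: a pair of [L] outside the rectangle lies in ([P] minus
     [A]) x [R] or in [P] x ([R] minus [B]). *)
  set (P := nodup classical_eq_dec (map fst L)); set (R := nodup classical_eq_dec (map snd L)).
  assert (NP : NoDup P) by apply NoDup_nodup.
  assert (NR : NoDup R) by apply NoDup_nodup.
  assert (T : labs F (outside (list_prod A B) L) <= d * N + M * d).
  { apply Rle_trans with
      (labs F (list_prod (outside A P) R ++ list_prod P (outside B R))).
    - apply labs_incl; [now apply NoDup_outside|].
      intros [i j] Hij; apply in_outside in Hij as [HL Hn].
      rewrite in_prod_iff in Hn; rewrite in_app_iff, !in_prod_iff, !in_outside.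
      assert (In i P) by (apply nodup_In; apply (in_map fst) in HL; auto).
      assert (In j R) by (apply nodup_In; apply (in_map snd) in HL; auto).
      destruct (in_dec classical_eq_dec i A); tauto.
    - unfold F; rewrite labs_app, !labs_list_prod.
      assert (labs f (outside A P) < d).
      { apply HA1; [now apply NoDup_outside|].
        intros i Hi Hi'; apply in_outside in Hi; apply IA1 in Hi'; tauto. }
      assert (labs g (outside B R) < d).
      { apply HB1; [now apply NoDup_outside|].
        intros i Hi Hi'; apply in_outside in Hi; apply IB1 in Hi'; tauto. }
      apply Rplus_le_compat; apply Rmult_le_compat; auto using labs_nonneg; lra. }
  specialize (HA2 A NA IA2); specialize (HB2 B NB IB2).
  pose proof (Rle_trans _ _ _ (Cmod_lsum f A) (HM A NA)) as HfA.
  pose proof (Cmod_lsum F (outside (list_prod A B) L)) as HT.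
  set (x := lsum f A) in *; set (y := lsum g B) in *.
  set (t := lsum F (outside (list_prod A B) L)) in *.
  replace (Cminus (Cplus (Cmult x y) t) (Cmult a b))
    with (Cplus (Cplus (Cmult x (Cminus y b)) (Cmult (Cminus x a) b)) t) by ring.
  pose proof (Cmod_triangle (Cplus (Cmult x (Cminus y b)) (Cmult (Cminus x a) b)) t).
  pose proof (Cmod_triangle (Cmult x (Cminus y b)) (Cmult (Cminus x a) b)).
  rewrite !Cmod_mult in *.
  pose proof (Cmod_ge_0 (Cminus y b)); pose proof (Cmod_ge_0 (Cminus x a)).
  pose proof (Cmod_ge_0 x).
  assert (Cmod x * Cmod (Cminus y b) <= M * d) by (apply Rmult_le_compat; lra).
  assert (Cmod (Cminus x a) * Cmod b <= d * Cmod b)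
    by (apply Rmult_le_compat_r; lra).
  unfold K in HdK; lra.
Qed.

(** * Geometrically bounded families indexed by the integers *)

Definition geom_bounded (K r : R) (f : Z -> C) : Prop :=
  forall n, Cmod (f n) <= K * r ^ Z.abs_nat n.

Lemma labs_seq_geom (K r : R) (a : nat -> C) (k s : nat) :
  0 < r < 1 -> (forall n, Cmod (a n) <= K * r ^ n) ->
  labs a (seq s k) <= K * r ^ s / (1 - r).
Proof.
  intros Hr Ha.
  assert (HK : 0 <= K).
  { specialize (Ha 0%nat); simpl in Ha; pose proof (Cmod_ge_0 (a 0%nat)); lra. }
  revert s; induction k as [|k IH]; intros s; simpl.
  - pose proof (pow_lt r s (proj1 Hr)).
    apply Rmult_le_pos; [nra|]; left; apply Rinv_0_lt_compat; lra.
  - specialize (IH (S s)); specialize (Ha s); simpl in IH.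
    replace (K * r ^ s / (1 - r)) with (K * r ^ s + K * (r * r ^ s) / (1 - r))
      by (field; lra).
    lra.
Qed.

Lemma labs_le {I : Type} (f g : I -> C) (L : list I) :
  (forall i, In i L -> Cmod (f i) <= Cmod (g i)) -> labs f L <= labs g L.
Proof.
  induction L as [|i L IH]; simpl; intros H; [lra|].
  apply Rplus_le_compat; auto.
Qed.

(** At most two integers share an absolute value, whence twice a geometric tail. *)
Lemma labs_tail_geom (K r : R) (f : Z -> C) (N : nat) (L : list Z) :
  0 < r < 1 -> 0 <= K -> NoDup L ->
  (forall n, In n L -> (N <= Z.abs_nat n)%nat /\ Cmod (f n) <= K * r ^ Z.abs_nat n) ->
  labs f L <= 2 * K * r ^ N / (1 - r).
Proof.
  intros Hr HK ND HL.
  (* The bound on [f] is known on [L] only, so the majorant [g] replaces [f] before [L] is enlarged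
     to a symmetric range of integers. *)
  set (g := fun n => RtoC (K * r ^ Z.abs_nat n)).
  assert (Hg : forall n, Cmod (g n) = K * r ^ Z.abs_nat n).
  { intros n; unfold g; rewrite Cmod_R; apply Rabs_pos_eq, Rmult_le_pos; auto.
    apply pow_le; lra. }
  set (k := list_max (map Z.abs_nat L)).
  assert (Hk : forall n, In n L -> (Z.abs_nat n <= k)%nat).
  { intros n Hn; pose proof (proj1 (list_max_le (map Z.abs_nat L) k) (le_n _)) as H.
    rewrite Forall_forall in H; apply H, in_map, Hn. }
  apply Rle_trans with (labs g L).
  { apply labs_le; intros n Hn; rewrite Hg; now apply HL. }
  apply Rle_trans with (labs g (map Z.of_nat (seq N (S k))
                               ++ map (fun n => Z.opp (Z.of_nat n)) (seq N (S k)))).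
  - apply labs_incl; auto; intros n Hn.
    destruct (HL n Hn) as [HN _]; specialize (Hk n Hn).
    apply in_app_iff; rewrite !in_map_iff.
    destruct (Z_le_dec 0 n); [left|right]; exists (Z.abs_nat n);
      rewrite in_seq; lia.
  - rewrite labs_app, !labs_map.
    replace (2 * K * r ^ N / (1 - r))
      with (K * r ^ N / (1 - r) + K * r ^ N / (1 - r)) by (field; lra).
    apply Rplus_le_compat; apply labs_seq_geom; auto; intros n;
      rewrite Hg; right; do 2 f_equal; lia.
Qed.

Lemma geom_bounded_nonneg (K r : R) (f : Z -> C) : geom_bounded K r f -> 0 <= K.
Proof.
  intros Hf; specialize (Hf 0%Z); simpl in Hf; pose proof (Cmod_ge_0 (f 0%Z)); lra.
Qed.

Lemma geom_tail_small (K r eps : R) :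
  0 < r < 1 -> 0 < eps -> exists N, 2 * K * r ^ N / (1 - r) < eps.
Proof.
  intros Hr He.
  set (c := 2 * Rabs K / (1 - r)).
  assert (Hc : 0 <= c).
  { pose proof (Rabs_pos K); unfold c; apply Rmult_le_pos; [lra|].
    left; apply Rinv_0_lt_compat; lra. }
  destruct (pow_lt_1_zero r ltac:(rewrite Rabs_pos_eq; lra) (eps / (c + 1)))
    as (N & HN).
  { apply Rdiv_lt_0_compat; lra. }
  exists N; specialize (HN N (le_n _)).
  pose proof (pow_lt r N (proj1 Hr)).
  rewrite Rabs_pos_eq in HN by lra.
  apply Rle_lt_trans with ((c + 1) * r ^ N).
  - unfold c; pose proof (Rle_abs K).
    replace (2 * K * r ^ N / (1 - r)) with (2 * K / (1 - r) * r ^ N) by (field; lra).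
    apply Rmult_le_compat_r; [lra|].
    assert (2 * K / (1 - r) <= 2 * Rabs K / (1 - r)); [|lra].
    apply Rmult_le_compat_r; [|lra]; left; apply Rinv_0_lt_compat; lra.
  - replace eps with ((c + 1) * (eps / (c + 1))) by (field; lra).
    apply Rmult_lt_compat_l; lra.
Qed.

(** The integers from -N to N - 1, listed as the first [N] indices of each of the two series in
    [CSeriesZ]. *)
Definition box (N : nat) : list Z :=
  map Z.of_nat (seq 0 N) ++ map (fun m => Z.opp (Z.of_nat (S m))) (seq 0 N).

Lemma NoDup_box (N : nat) : NoDup (box N).
Proof.
  unfold box; apply NoDup_app.
  - apply FinFun.Injective_map_NoDup; [intros x y; lia|apply seq_NoDup].
  - apply FinFun.Injective_map_NoDup; [intros x y; lia|apply seq_NoDup].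
  - intros n H H'; rewrite in_map_iff in *.
    destruct H as (x & ? & _), H' as (y & ? & _); lia.
Qed.

Lemma notin_box (N : nat) (n : Z) : ~ In n (box N) -> (N <= Z.abs_nat n)%nat.
Proof.
  intros H; destruct (le_lt_dec N (Z.abs_nat n)) as [|Hlt]; auto; exfalso; apply H.
  unfold box; rewrite in_app_iff, !in_map_iff.
  destruct (Z_le_dec 0 n); [left|right].
  - exists (Z.abs_nat n); rewrite in_seq; lia.
  - exists (pred (Z.abs_nat n)); rewrite in_seq; lia.
Qed.

Lemma geom_abs_summable (K r : R) (f : Z -> C) :
  0 < r < 1 -> geom_bounded K r f -> abs_summable f.
Proof.
  intros Hr Hf eps He; destruct (geom_tail_small K r eps Hr He) as (N & HN).
  exists (box N); intros L ND HL.
  eapply Rle_lt_trans; [|apply HN]; apply labs_tail_geom;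
    eauto using geom_bounded_nonneg.
  intros n Hn; split; [apply notin_box; auto|apply Hf].
Qed.

(** * Comparison with the two-sided series *)

Lemma lsum_seq_Series (u : nat -> R) :
  ex_series u -> forall eps, 0 < eps -> exists N0, forall N, (N0 <= N)%nat ->
  Rabs (fold_right (fun i s => u i + s) 0 (seq 0 N) - Series u) < eps.
Proof.
  intros Hu eps He.
  assert (Hl : is_lim_seq (sum_n u) (Series u)) by exact (Series_correct u Hu).
  apply is_lim_seq_spec in Hl; destruct (Hl (mkposreal eps He)) as (N0 & H).
  (* [sum_n u N] has [N + 1] terms, whereas [seq 0 N] has [N]. *)
  exists (S N0); intros N HN; destruct N as [|N]; [lia|].
  specialize (H N ltac:(lia)); simpl in H.
  replace (fold_right (fun i s => u i + s) 0 (seq 0 (S N))) with (sum_n u N); auto.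
  clear; induction N as [|N IH].
  - rewrite sum_O; simpl; ring.
  - rewrite sum_Sn, IH, (seq_S (S N) 0), fold_right_app; simpl Nat.add.
    generalize (seq 0 (S N)) as l; intros l; clear IH.
    change plus with Rplus.
    induction l as [|i l IH]; simpl in *; [|rewrite <- IH]; ring.
Qed.

Lemma Cmod_le_Re_Im (z : C) : Cmod z <= Rabs (Re z) + Rabs (Im z).
Proof.
  destruct z as [x y]; simpl.
  replace (x, y) with (Cplus (RtoC x) (Cmult Ci (RtoC y)))
    by (unfold Cplus, Cmult, Ci, RtoC; simpl; f_equal; ring).
  eapply Rle_trans; [apply Cmod_triangle|].
  rewrite Cmod_mult, !Cmod_R.
  replace (Cmod Ci) with 1; [lra|].
  unfold Cmod, Ci; simpl; replace (0 * (0 * 1) + 1 * (1 * 1)) with 1 by ring.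
  now rewrite sqrt_1.
Qed.

Lemma im_le_Cmod (z : C) : Rabs (Im z) <= Cmod z.
Proof.
  eapply Rle_trans; [|apply Rmax_Cmod]; apply Rmax_r.
Qed.

Lemma CSeries_geom (K r : R) (a : nat -> C) :
  0 < r < 1 -> (forall n, Cmod (a n) <= K * r ^ n) ->
  forall eps, 0 < eps -> exists N0, forall N, (N0 <= N)%nat ->
  Cmod (Cminus (lsum a (seq 0 N)) (CSeries a)) < eps.
Proof.
  intros Hr Ha eps He.
  assert (G : ex_series (fun n => K * r ^ n)).
  { apply (ex_series_scal K (fun n => r ^ n)), ex_series_geom.
    rewrite Rabs_pos_eq; lra. }
  assert (ERe : ex_series (fun n => Re (a n))).
  { apply (ex_series_le (K := R_AbsRing) (V := R_CompleteNormedModule)) with (2 := G).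
    intros n; eapply Rle_trans; [apply re_le_Cmod|apply Ha]. }
  assert (EIm : ex_series (fun n => Im (a n))).
  { apply (ex_series_le (K := R_AbsRing) (V := R_CompleteNormedModule)) with (2 := G).
    intros n; eapply Rle_trans; [apply im_le_Cmod|apply Ha]. }
  destruct (lsum_seq_Series _ ERe (eps / 2)) as (N1 & H1); [lra|].
  destruct (lsum_seq_Series _ EIm (eps / 2)) as (N2 & H2); [lra|].
  exists (N1 + N2)%nat; intros N HN.
  specialize (H1 N ltac:(lia)); specialize (H2 N ltac:(lia)).
  eapply Rle_lt_trans; [apply Cmod_le_Re_Im|].
  assert (E : lsum a (seq 0 N)
      = (fold_right (fun i s => Re (a i) + s) 0 (seq 0 N),
         fold_right (fun i s => Im (a i) + s) 0 (seq 0 N))).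
  { generalize (seq 0 N); intros l; induction l as [|i l IH]; simpl; auto.
    now rewrite IH. }
  rewrite E; unfold CSeries, Cminus, Cplus, Copp; simpl.
  simpl in H1, H2; unfold Rminus in H1, H2; lra.
Qed.

(** Three errors of size [eps / 3]: one for each half of [CSeriesZ] truncated at [N], and one for
    the indices outside [box N]. *)
Lemma geom_has_sum (K r : R) (f : Z -> C) :
  0 < r < 1 -> geom_bounded K r f -> has_sum f (CSeriesZ f).
Proof.
  intros Hr Hf eps He.
  pose proof (geom_bounded_nonneg K r f Hf) as HK.
  destruct (geom_tail_small K r (eps / 3) Hr) as (N1 & H1); [lra|].
  destruct (CSeries_geom K r (fun n => f (Z.of_nat n)) Hr) with (eps := eps / 3)
    as (N2 & H2); [|lra|].
  { intros n; eapply Rle_trans; [apply Hf|]; right; do 2 f_equal; lia. }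
  destruct (CSeries_geom K r (fun m => f (Z.opp (Z.of_nat (S m)))) Hr)
    with (eps := eps / 3) as (N3 & H3); [|lra|].
  { intros n; eapply Rle_trans; [apply Hf|].
    (* The negative half starts at -1, which gives a surplus factor [r < 1]. *)
    replace (Z.abs_nat (- Z.of_nat (S n))) with (S n) by lia; simpl.
    pose proof (pow_lt r n (proj1 Hr)); apply Rmult_le_compat_l; nra. }
  set (N := (N1 + N2 + N3)%nat).
  exists (box N); intros L ND Hincl.
  specialize (H2 N ltac:(lia)); specialize (H3 N ltac:(lia)).
  rewrite (lsum_split f (box N) L) by auto using NoDup_box.
  assert (T : Cmod (lsum f (outside (box N) L)) < eps / 3).
  { eapply Rle_lt_trans; [apply Cmod_lsum|].
    eapply Rle_lt_trans; [apply (labs_tail_geom K r f N1)|apply H1]; auto.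
    - now apply NoDup_outside.
    - intros n Hn; apply in_outside in Hn as [_ Hn]; apply notin_box in Hn.
      split; [lia|apply Hf]. }
  unfold box at 1; rewrite lsum_app, !lsum_map; unfold CSeriesZ.
  match goal with |- Cmod (Cminus (Cplus (Cplus ?x ?y) ?t) (Cplus ?a ?b)) < _ =>
    replace (Cminus (Cplus (Cplus x y) t) (Cplus a b))
      with (Cplus (Cplus (Cminus x a) (Cminus y b)) t) by ring;
    pose proof (Cmod_triangle (Cplus (Cminus x a) (Cminus y b)) t);
    pose proof (Cmod_triangle (Cminus x a) (Cminus y b)) end.
  lra.
Qed.

(** Bounds the truncation error of a sum by the mass of the omitted terms; it serves for the
    q-expansion. *)
Lemma has_sum_error {I : Type} (f : I -> C) (l : C) (L0 : list I) (B : R) :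
  has_sum f l -> NoDup L0 ->
  (forall L, NoDup L -> (forall i, In i L -> ~ In i L0) -> labs f L <= B) ->
  Cmod (Cminus l (lsum f L0)) <= B.
Proof.
  intros H ND0 HB; apply le_epsilon; intros eps He.
  destruct (H eps He) as (L1 & HL).
  set (L := nodup classical_eq_dec (L0 ++ L1)).
  assert (ND : NoDup L) by apply NoDup_nodup.
  specialize (HL L ND ltac:(intros i Hi; apply nodup_In, in_app_iff; auto)).
  rewrite (lsum_split f L0 L) in HL; auto;
    [|intros i Hi; apply nodup_In, in_app_iff; auto].
  specialize (HB (outside L0 L) (NoDup_outside L0 L ND)
    ltac:(intros i Hi; now apply in_outside in Hi)).
  pose proof (Cmod_lsum f (outside L0 L)).
  set (t := lsum f (outside L0 L)) in *; set (s := lsum f L0) in *.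
  replace (Cminus l s) with (Cplus t (Copp (Cminus (Cplus s t) l))) by ring.
  eapply Rle_trans; [apply Cmod_triangle|]; rewrite Cmod_opp; lra.
Qed.

(** * Theta constants with real characteristics *)

Lemma cexp_plus (x y : C) : cexp (Cplus x y) = Cmult (cexp x) (cexp y).
Proof.
  destruct x as [x1 x2], y as [y1 y2]; unfold cexp, Cmult, Cplus; simpl.
  rewrite exp_plus, cos_plus, sin_plus; f_equal; ring.
Qed.

Lemma Cmod_cexp (x : C) : Cmod (cexp x) = exp (Re x).
Proof.
  unfold cexp, Cmod; simpl.
  replace (_ + _) with ((exp (Re x))² * ((sin (Im x))² + (cos (Im x))²))
    by (unfold Rsqr; ring).
  rewrite sin2_cos2, Rmult_1_r; apply sqrt_Rsqr; left; apply exp_pos.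
Qed.

Lemma cexp_0 : cexp (0, 0) = RtoC 1.
Proof. unfold cexp, RtoC; simpl; rewrite exp_0, cos_0, sin_0; f_equal; ring. Qed.

Lemma cexp_2PI_Z (n : Z) : cexp (0, 2 * PI * IZR n) = RtoC 1.
Proof.
  assert (N : forall k : nat, cexp (0, 2 * PI * INR k) = RtoC 1).
  { induction k as [|k IH].
    - simpl; rewrite Rmult_0_r; apply cexp_0.
    - rewrite S_INR.
      replace (0, 2 * PI * (INR k + 1)) with (Cplus (0, 2 * PI * INR k) (0, 2 * PI))
        by (unfold Cplus; simpl; f_equal; ring).
      rewrite cexp_plus, IH; unfold cexp, RtoC, Cmult; simpl.
      rewrite exp_0, cos_2PI, sin_2PI; f_equal; ring. }
  destruct (Z_le_dec 0 n) as [H|H].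
  - rewrite <- (Z2Nat.id n H), <- INR_IZR_INZ; apply N.
  - pose proof (N (Z.to_nat (- n))) as E.
    rewrite INR_IZR_INZ, Z2Nat.id, opp_IZR in E by lia.
    transitivity (Cmult (cexp (0, 2 * PI * IZR n)) (cexp (0, 2 * PI * - IZR n))).
    + rewrite E; ring.
    + rewrite <- cexp_plus, <- cexp_0.
      f_equal; unfold Cplus; simpl; f_equal; ring.
Qed.

(** The exponential of pi i ((n + a)^2 tau + 2 (n + a) b), split into real and imaginary parts; [a]
    and [b] are half the usual characteristics. *)
Definition theta_term (a b : R) (tau : C) (n : Z) : C :=
  cexp (- PI * (IZR n + a) ^ 2 * Im tau,
        PI * ((IZR n + a) ^ 2 * Re tau + 2 * (IZR n + a) * b)).

Definition Theta (a b : R) (tau : C) : C := CSeriesZ (theta_term a b tau).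

Lemma theta_const_Theta (eps eps' : R) (tau : C) :
  theta_const eps eps' tau = Theta (eps / 2) (eps' / 2) tau.
Proof.
  assert (E : forall n, (let a : R := IZR n + eps / 2 in
    cexp (Cmult (Cmult (RtoC 2) (Cmult (RtoC PI) Ci))
      (Cplus (Cmult (RtoC (a * a / 2)) tau)
             (Cmult (RtoC a) (Cplus (RtoC 0) (RtoC (eps' / 2)))))))
    = theta_term (eps / 2) (eps' / 2) tau n).
  { intros n; unfold theta_term; cbv zeta; f_equal.
    destruct tau as [x y]; unfold Cmult, Cplus, RtoC, Ci; simpl; f_equal; field. }
  unfold theta_const, theta, Theta, CSeriesZ, CSeries; f_equal; f_equal;
    apply Series_ext; intros n; rewrite E; reflexivity.
Qed.

Lemma exp_INR_mult (n : nat) (x : R) : exp (INR n * x) = exp x ^ n.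
Proof.
  induction n as [|n IH].
  - simpl; rewrite Rmult_0_l; apply exp_0.
  - rewrite S_INR; simpl; rewrite <- IH, <- exp_plus; f_equal; ring.
Qed.

Lemma exp_le_mono (x y : R) : x <= y -> exp x <= exp y.
Proof. intros [H| ->]; [left; now apply exp_increasing|lra]. Qed.

(** Gaussian decay is weakened to geometric decay by (n + a)^2 >= |n + a| - 1 >= |n| - |a| - 1. *)
Lemma geom_bounded_theta_term (a b : R) (tau : C) :
  in_H2 tau ->
  geom_bounded (exp (PI * Im tau * (1 + Rabs a))) (exp (- (PI * Im tau)))
    (theta_term a b tau).
Proof.
  unfold in_H2; intros Hy n.
  unfold theta_term; rewrite Cmod_cexp; simpl Re.
  pose proof PI_RGT_0 as Hpi.
  rewrite <- exp_INR_mult, <- exp_plus; apply exp_le_mono.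
  assert (Hn : INR (Z.abs_nat n) = Rabs (IZR n)).
  { rewrite INR_IZR_INZ, Nat2Z.inj_abs_nat; apply abs_IZR. }
  rewrite Hn.
  assert (Rabs (IZR n) <= Rabs (IZR n + a) + Rabs a).
  { pose proof (Rabs_triang (IZR n + a) (- a)) as T; rewrite Rabs_Ropp in T.
    replace (IZR n + a + - a) with (IZR n) in T by ring; exact T. }
  assert (Rabs (IZR n + a) - 1 <= (IZR n + a) ^ 2).
  { rewrite <- pow2_abs; pose proof (Rabs_pos (IZR n + a)); nra. }
  assert (0 < PI * Im tau) by (apply Rmult_lt_0_compat; lra).
  nra.
Qed.

Lemma theta_ratio_bounds (tau : C) : in_H2 tau -> 0 < exp (- (PI * Im tau)) < 1.
Proof.
  unfold in_H2; intros Hy; split; [apply exp_pos|].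
  rewrite <- exp_0; apply exp_increasing.
  pose proof (Rmult_lt_0_compat PI (Im tau) PI_RGT_0 Hy); lra.
Qed.

Lemma has_sum_Theta (a b : R) (tau : C) :
  in_H2 tau -> has_sum (theta_term a b tau) (Theta a b tau).
Proof.
  intros H; exact (geom_has_sum _ _ _ (theta_ratio_bounds tau H)
                     (geom_bounded_theta_term a b tau H)).
Qed.

Lemma abs_summable_theta_term (a b : R) (tau : C) :
  in_H2 tau -> abs_summable (theta_term a b tau).
Proof.
  intros H; exact (geom_abs_summable _ _ _ (theta_ratio_bounds tau H)
                     (geom_bounded_theta_term a b tau H)).
Qed.

(** * Shifts and reflection of the characteristics *)

Lemma Theta_shift (a b : R) (tau : C) :
  in_H2 tau -> Theta (a + 1) b tau = Theta a b tau.
Proof.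
  intros H; apply (has_sum_unique (theta_term (a + 1) b tau)).
  - now apply has_sum_Theta.
  - apply has_sum_ext with (fun n => theta_term a b tau (n + 1)).
    + intros n; unfold theta_term; rewrite plus_IZR; do 2 f_equal; ring.
    + apply (has_sum_reindex (fun n => n + 1)%Z (fun n => n - 1)%Z);
        [intros; lia|intros; lia|now apply has_sum_Theta].
Qed.

Lemma Theta_opp (a b : R) (tau : C) :
  in_H2 tau -> Theta (- a) (- b) tau = Theta a b tau.
Proof.
  intros H; apply (has_sum_unique (theta_term (- a) (- b) tau)).
  - now apply has_sum_Theta.
  - apply has_sum_ext with (fun n => theta_term a b tau (- n)).
    + intros n; unfold theta_term; rewrite opp_IZR; do 2 f_equal; ring.
    + apply (has_sum_reindex Z.opp Z.opp);
        [intros; lia|intros; lia|now apply has_sum_Theta].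
Qed.

(** Each term gains exp (2 pi i (n + a)), where the factor exp (2 pi i n) is 1. *)
Lemma Theta_shift_snd (a b : R) (tau : C) :
  in_H2 tau -> Theta a (b + 1) tau = Cmult (cexp (0, 2 * PI * a)) (Theta a b tau).
Proof.
  intros H; apply (has_sum_unique (theta_term a (b + 1) tau)).
  - now apply has_sum_Theta.
  - apply has_sum_ext with
      (fun n => Cmult (cexp (0, 2 * PI * a)) (theta_term a b tau n));
      [|now apply has_sum_scal, has_sum_Theta].
    intros n; unfold theta_term.
    rewrite <- (Cmult_1_l (cexp (0, _))), <- (cexp_2PI_Z n), <- !cexp_plus.
    unfold Cplus; simpl; do 2 f_equal; ring.
Qed.

(* The substitution (m, n) = (c + l, c - l) or (c + l + 1, c - l), according to
   the parity of m + n, diagonalises the quadratic form m^2 + n^2. *)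
Definition parity_join (s : (Z * Z) + (Z * Z)) : Z * Z :=
  match s with
  | inl (c, l) => (c + l, c - l)%Z
  | inr (c, l) => (c + l + 1, c - l)%Z
  end.

Definition parity_split (p : Z * Z) : (Z * Z) + (Z * Z) :=
  let (m, n) := p in
  if Z.even (m + n) then inl ((m + n) / 2, (m - n) / 2)%Z
  else inr ((m + n - 1) / 2, (m - n - 1) / 2)%Z.

Lemma parity_splitK (p : Z * Z) : parity_join (parity_split p) = p.
Proof.
  destruct p as [m n]; unfold parity_split.
  destruct (Z.even (m + n)) eqn:E; simpl.
  - apply Z.even_spec in E as [k Hk].
    replace (m - n)%Z with ((k - n) * 2)%Z by lia.
    replace (m + n)%Z with (k * 2)%Z by lia.
    rewrite !Z.div_mul by lia; f_equal; lia.
  - rewrite <- Z.negb_odd in E; apply Bool.negb_false_iff, Z.odd_spec in E as [k Hk].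
    replace (m - n - 1)%Z with ((k - n) * 2)%Z by lia.
    replace (m + n - 1)%Z with (k * 2)%Z by lia.
    rewrite !Z.div_mul by lia; f_equal; lia.
Qed.

Lemma parity_joinK (s : (Z * Z) + (Z * Z)) : parity_split (parity_join s) = s.
Proof.
  destruct s as [[c l]|[c l]]; unfold parity_join, parity_split.
  - replace (c + l + (c - l))%Z with (c * 2)%Z by lia.
    replace (c + l - (c - l))%Z with (l * 2)%Z by lia.
    rewrite Z.even_mul, Bool.orb_true_r, !Z.div_mul by lia; reflexivity.
  - replace (c + l + 1 + (c - l))%Z with (1 + 2 * c)%Z by lia.
    replace (c + l + 1 - (c - l) - 1)%Z with (l * 2)%Z by lia.
    rewrite Z.even_add_mul_2; simpl Z.even.
    replace (1 + 2 * c - 1)%Z with (c * 2)%Z by lia.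
    rewrite !Z.div_mul by lia; reflexivity.
Qed.

(** For (m, n) = (c + l, c - l) one has (m + a)^2 + (n + a')^2 = 2 ((c + (a + a')/2)^2 + (l + (a -
    a')/2)^2), and the linear terms separate likewise. The odd case replaces [a] by [a + 1]. The
    factor 2 becomes the doubled modulus. *)
Lemma Theta_mult (a b a' b' : R) (tau : C) :
  in_H2 tau ->
  let tau2 := Cmult (RtoC 2) tau in
  Cmult (Theta a b tau) (Theta a' b' tau)
  = Cplus (Cmult (Theta ((a + a') / 2) (b + b') tau2)
                 (Theta ((a - a') / 2) (b - b') tau2))
          (Cmult (Theta ((a + a' + 1) / 2) (b + b') tau2)
                 (Theta ((a - a' + 1) / 2) (b - b') tau2)).
Proof.
  intros H tau2.
  assert (H2 : in_H2 tau2).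
  { unfold in_H2, tau2 in *; destruct tau; simpl in *; lra. }
  set (F := fun p => Cmult (theta_term a b tau (fst p)) (theta_term a' b' tau (snd p))).
  apply (has_sum_unique (fun s => F (parity_join s))).
  - apply (has_sum_reindex _ parity_split);
      auto using parity_splitK, parity_joinK.
    apply has_sum_mult; auto using has_sum_Theta, abs_summable_theta_term.
  - apply has_sum_disjoint_union.
    + apply has_sum_ext with (fun p =>
        Cmult (theta_term ((a + a') / 2) (b + b') tau2 (fst p))
              (theta_term ((a - a') / 2) (b - b') tau2 (snd p))).
      * intros [c l]; unfold F, parity_join, theta_term, tau2; simpl fst; simpl snd.
        rewrite <- !cexp_plus, plus_IZR, minus_IZR.
        destruct tau as [x y]; unfold Cplus; simpl; do 2 f_equal; field.
      * apply has_sum_mult; auto using has_sum_Theta, abs_summable_theta_term.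
    + apply has_sum_ext with (fun p =>
        Cmult (theta_term ((a + a' + 1) / 2) (b + b') tau2 (fst p))
              (theta_term ((a - a' + 1) / 2) (b - b') tau2 (snd p))).
      * intros [c l]; unfold F, parity_join, theta_term, tau2; simpl fst; simpl snd.
        rewrite <- !cexp_plus, !plus_IZR, minus_IZR.
        destruct tau as [x y]; unfold Cplus; simpl; do 2 f_equal; field.
      * apply has_sum_mult; auto using has_sum_Theta, abs_summable_theta_term.
Qed.

(** * The relation between the theta constants of level five *)

(** With a' = 1/2, the first characteristics in the two products of [Theta_mult] are the same pair
    3/10 and 4/5 modulo 1, in exchanged order. Hence only [g] and [h] occur, with [x] and [y]
    separated. *)
Lemma Theta_bracket (x y : R) (tau : C) :
  in_H2 tau ->
  let g t := Theta (3 / 10) (t / 5) (Cmult (RtoC 2) tau) in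
  let h t := Theta (4 / 5) (t / 5) (Cmult (RtoC 2) tau) in
  Cmult (Theta (1 / 10) ((x + y - 5) / 10) tau) (Theta (1 / 2) ((x - y + 5) / 10) tau)
  = Cmult (cexp (0, - (3 * PI / 5))) (Cminus (Cmult (h x) (g y)) (Cmult (g x) (h y))).
Proof.
  intros H g h.
  assert (H2 : in_H2 (Cmult (RtoC 2) tau)).
  { unfold in_H2 in *; destruct tau; simpl in *; lra. }
  rewrite Theta_mult by auto.
  replace ((1 / 10 + 1 / 2) / 2) with (3 / 10) by field.
  replace ((1 / 10 + 1 / 2 + 1) / 2) with (4 / 5) by field.
  replace ((1 / 10 - 1 / 2 + 1) / 2) with (3 / 10) by field.
  replace ((x + y - 5) / 10 + (x - y + 5) / 10) with (x / 5) by field.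
  replace ((x + y - 5) / 10 - (x - y + 5) / 10) with (y / 5 - 1) by field.
  rewrite <- (Theta_shift ((1 / 10 - 1 / 2) / 2)) by auto.
  replace ((1 / 10 - 1 / 2) / 2 + 1) with (4 / 5) by field.
  fold (g x); fold (h x).
  assert (Eg : g y = Cmult (cexp (0, 2 * PI * (3 / 10)))
                       (Theta (3 / 10) (y / 5 - 1) (Cmult (RtoC 2) tau))).
  { unfold g; rewrite <- Theta_shift_snd by auto; f_equal; ring. }
  assert (Eh : h y = Cmult (cexp (0, 2 * PI * (4 / 5)))
                       (Theta (4 / 5) (y / 5 - 1) (Cmult (RtoC 2) tau))).
  { unfold h; rewrite <- Theta_shift_snd by auto; f_equal; ring. }
  rewrite Eg, Eh.
  assert (P1 : Cmult (cexp (0, - (3 * PI / 5))) (cexp (0, 2 * PI * (3 / 10))) = RtoC 1).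
  { rewrite <- cexp_plus, <- cexp_0; unfold Cplus; simpl; do 2 f_equal; field. }
  (* Undoing the shift by -1 costs exp (-2 pi i 3/10) and exp (-2 pi i 4/5). These differ by the
     factor exp (pi i) = -1, which turns the sum of products into a determinant. *)
  assert (P2 : Cmult (cexp (0, - (3 * PI / 5))) (cexp (0, 2 * PI * (4 / 5))) = Copp (RtoC 1)).
  { rewrite <- cexp_plus; unfold Cplus, Copp, cexp, RtoC; simpl.
    replace (- (3 * PI / 5) + 2 * PI * (4 / 5)) with PI by field.
    rewrite Rplus_0_l, exp_0, cos_PI, sin_PI; f_equal; ring. }
  set (u := Theta (3 / 10) _ _) in *; set (v := Theta (4 / 5) (y / 5 - 1) _) in *.
  set (w := cexp (0, - (3 * PI / 5))) in *.
  set (a := cexp (0, 2 * PI * (3 / 10))) in *.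
  set (b := cexp (0, 2 * PI * (4 / 5))) in *.
  transitivity (Cminus (Cmult (Cmult w a) (Cmult (h x) u))
                       (Cmult (Cmult w b) (Cmult (g x) v))); [|ring].
  rewrite P1, P2; ring.
Qed.

Lemma Cmult_eq_0 (a b : C) : Cmult a b = RtoC 0 -> a = RtoC 0 \/ b = RtoC 0.
Proof.
  intros H; destruct (Ceq_dec a (RtoC 0)); auto.
  destruct (Ceq_dec b (RtoC 0)); auto.
  exfalso; revert H; now apply Cmult_neq_0.
Qed.

(** Reflection sends 1/2 to -1/2, which is 1/2 modulo 1. *)
Lemma Theta_half_even (b : R) (tau : C) :
  in_H2 tau -> Theta (1 / 2) (- b) tau = Theta (1 / 2) b tau.
Proof.
  intros H; rewrite <- (Theta_opp (1 / 2) b), <- (Theta_shift (- (1 / 2))) by auto.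
  f_equal; field.
Qed.

Lemma theta_relation (tau : C) :
  in_H2 tau ->
  let e k := Theta (1 / 10) (k / 10) tau in
  Cmult (Cminus (Cmult (Cmult (e 3) (e 3)) (e 9)) (Cmult (e 1) (Cmult (e 7) (e 7))))
        (Theta (1 / 2) (1 / 10) tau)
  = Cmult (Cminus
             (Cmult (cexp (0, PI / 5)) (Cmult (Cmult (e 1) (e 1)) (e 3)))
             (Cmult (cexp (0, - (PI / 5))) (Cmult (e 7) (Cmult (e 9) (e 9)))))
          (Theta (1 / 2) (3 / 10) tau).
Proof.
  intros H e.
  set (A1 := Theta (1 / 2) (1 / 10) tau); set (A3 := Theta (1 / 2) (3 / 10) tau).
  set (lam := cexp (0, PI / 5)); set (mu := cexp (0, - (PI / 5))).
  set (g t := Theta (3 / 10) (t / 5) (Cmult (RtoC 2) tau)).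
  set (h t := Theta (4 / 5) (t / 5) (Cmult (RtoC 2) tau)).
  set (D x y := Cmult (cexp (0, - (3 * PI / 5)))
                  (Cminus (Cmult (h x) (g y)) (Cmult (g x) (h y)))).
  assert (B : forall x y k, x + y - 5 = k ->
    (x - y + 5 = 1 \/ x - y + 5 = -1 -> Cmult (e k) A1 = D x y) /\
    (x - y + 5 = 3 \/ x - y + 5 = -3 -> Cmult (e k) A3 = D x y)).
  { intros x y k <-.
    pose proof (Theta_bracket x y tau H) as E; cbv zeta in E.
    unfold D, g, h, A1, A3, e; rewrite <- E.
    split; (intros [Ej|Ej]; rewrite Ej; [reflexivity|]).
    - replace (-1 / 10) with (- (1 / 10)) by field.
      now rewrite Theta_half_even.
    - replace (-3 / 10) with (- (3 / 10)) by field.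
      now rewrite Theta_half_even. }
  (* The pairs (7, 9) and (1, 3) produce the indices 11 and -1; a shift of the second characteristic
     by 1 brings them back to 1 and 9. *)
  assert (E11 : e 11 = Cmult lam (e 1)).
  { unfold e, lam; replace (11 / 10) with (1 / 10 + 1) by field.
    rewrite Theta_shift_snd by auto; do 3 f_equal; field. }
  assert (Em1 : e (-1) = Cmult mu (e 9)).
  { unfold e, mu; replace (9 / 10) with (-1 / 10 + 1) by field.
    rewrite Theta_shift_snd, Cmult_assoc, <- cexp_plus by auto.
    replace (Cplus (0, - (PI / 5)) (0, 2 * PI * (1 / 10))) with ((0, 0) : C)
      by (unfold Cplus; simpl; f_equal; field).
    rewrite cexp_0; ring. }
  clearbody e A1 A3 lam mu g h.
  (* As y - x is 2, 4, 6 or 8, the index x - y + 5 is 3, 1, -1 or -3, so by evenness only [A1] and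
     [A3] appear. *)
  assert (D13 : Cmult (e (-1)) A3 = D 1 3) by (apply B; lra).
  assert (D15 : Cmult (e 1) A1 = D 1 5) by (apply B; lra).
  assert (D17 : Cmult (e 3) A1 = D 1 7) by (apply B; lra).
  assert (D19 : Cmult (e 5) A3 = D 1 9) by (apply B; lra).
  assert (D35 : Cmult (e 3) A3 = D 3 5) by (apply B; lra).
  assert (D37 : Cmult (e 5) A1 = D 3 7) by (apply B; lra).
  assert (D39 : Cmult (e 7) A1 = D 3 9) by (apply B; lra).
  assert (D57 : Cmult (e 7) A3 = D 5 7) by (apply B; lra).
  assert (D59 : Cmult (e 9) A1 = D 5 9) by (apply B; lra).
  assert (D79 : Cmult (e 11) A3 = D 7 9) by (apply B; lra).
  assert (Plucker : forall x y z t,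
    Cplus (Cminus (Cmult (D x y) (D z t)) (Cmult (D x z) (D y t)))
          (Cmult (D x t) (D y z)) = RtoC 0) by (intros; unfold D; ring).
  (* The relation [Rj] omits the vector of index j. *)
  pose proof (Plucker 3 5 7 9) as R1; pose proof (Plucker 1 5 7 9) as R3.
  pose proof (Plucker 1 3 5 9) as R7; pose proof (Plucker 1 3 5 7) as R9.
  rewrite <- D35, <- D79, <- D37, <- D59, <- D39, <- D57, E11 in R1.
  rewrite <- D15, <- D79, <- D17, <- D59, <- D19, <- D57, E11 in R3.
  rewrite <- D13, <- D59, <- D15, <- D39, <- D19, <- D35, Em1 in R7.
  rewrite <- D13, <- D57, <- D15, <- D37, <- D17, <- D35, Em1 in R9.
  clear -R1 R3 R7 R9; revert R1 R3 R7 R9.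
  generalize (e 1) (e 3) (e 5) (e 7) (e 9); clear e.
  intros e1 e3 e5 e7 e9 R1 R3 R7 R9.
  match goal with |- ?l = ?r => set (X := Cminus l r);
    assert (X3 : Cmult A3 X = RtoC 0); [|assert (X1 : Cmult A1 X = RtoC 0)] end.
  (* In [R1] and [R9] the number [e5] occurs with [e9 * A1^2] and [e1 * A1^2], so
     [e9 * R9 - e1 * R1] is free of it. *)
  - match type of R1 with ?p = _ => match type of R9 with ?q = _ =>
      transitivity (Cminus (Cmult e9 q) (Cmult e1 p)); [unfold X; ring|] end end.
    rewrite R1, R9; ring.
  (* Here [e5] occurs with [e7 * A3^2] and [e3 * A3^2], so [e7 * R7 - e3 * R3] is free of it. *)
  - match type of R3 with ?p = _ => match type of R7 with ?q = _ =>
      transitivity (Cminus (Cmult e7 q) (Cmult e3 p)); [unfold X; ring|] end end.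
    rewrite R3, R7; ring.
  - assert (HX : X = RtoC 0).
    { apply Cmult_eq_0 in X3 as [E3|]; auto; apply Cmult_eq_0 in X1 as [E1|]; auto.
      unfold X; rewrite E1, E3; ring. }
    unfold X in HX.
    match goal with |- ?l = ?r => replace l with (Cplus (Cminus l r) r) by ring end.
    rewrite HX; ring.
Qed.

(** * Non-vanishing of the denominator on the imaginary axis *)

Lemma cexp_polar (x y : R) : cexp (x, y) = Cmult (RtoC (exp x)) (cexp (0, y)).
Proof. unfold cexp, RtoC, Cmult; simpl; rewrite exp_0; f_equal; ring. Qed.

(* Beyond the terms n = 0, -1, the exponents satisfy 5 n^2 + n >= 4 + 2 |n|. *)
Lemma Theta_expansion (y k : R) :
  0 < y ->
  let p := exp (- (PI * y / 5)) in
  Cmod (Cminus (Cmult (cexp (PI * y / 100, - (PI * k / 50)))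
                      (Theta (1 / 10) (k / 10) (0, y)))
               (Cplus (RtoC 1) (Cmult (RtoC (p ^ 4)) (cexp (0, - (PI * k / 5))))))
  <= 2 * p ^ 4 * (p ^ 2) ^ 1 / (1 - p ^ 2).
Proof.
  intros Hy p.
  (* The inverse of the term n = 0, so that the normalised series starts with 1 and its term n = -1
     has modulus [p ^ 4]. *)
  set (c := cexp (PI * y / 100, - (PI * k / 50))).
  set (f := fun n => Cmult c (theta_term (1 / 10) (k / 10) (0, y) n)).
  assert (Ef : forall n, f n = cexp (- (PI * y / 5) * (5 * IZR n ^ 2 + IZR n),
                                     PI * k / 5 * IZR n)).
  { intros n; unfold f, c, theta_term; rewrite <- cexp_plus.
    unfold Cplus; simpl; do 2 f_equal; field. }
  assert (Hpy : 0 < PI * y / 5).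
  { pose proof (Rmult_lt_0_compat PI y PI_RGT_0 Hy); lra. }
  assert (Hp : 0 < p < 1).
  { split; [apply exp_pos|]; rewrite <- exp_0; apply exp_increasing; lra. }
  replace (Cplus (RtoC 1) (Cmult (RtoC (p ^ 4)) (cexp (0, - (PI * k / 5)))))
    with (lsum f (0 :: -1 :: nil)%Z).
  - apply has_sum_error.
    + apply has_sum_scal, has_sum_Theta; exact Hy.
    + repeat constructor; simpl; intuition lia.
    + intros L ND HL; apply labs_tail_geom; auto.
      * nra.
      * apply pow_le; lra.
      * intros n Hn; specialize (HL n Hn); simpl in HL; split; [lia|].
        rewrite Ef, Cmod_cexp; simpl Re; unfold p.
        rewrite <- pow_mult, <- pow_add, <- exp_INR_mult; apply exp_le_mono.
        assert (4 + 2 * INR (Z.abs_nat n) <= 5 * IZR n ^ 2 + IZR n).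
        { rewrite INR_IZR_INZ, Nat2Z.inj_abs_nat.
          replace (5 * IZR n ^ 2 + IZR n) with (IZR (5 * (n * n) + n))
            by (rewrite plus_IZR, !mult_IZR; ring).
          rewrite <- mult_IZR, <- plus_IZR; apply IZR_le.
          destruct (Z_le_dec 0 n); nia. }
        rewrite plus_INR, mult_INR; simpl INR; nra.
  - change (lsum f (0 :: -1 :: nil)%Z)
      with (Cplus (f 0%Z) (Cplus (f (-1)%Z) (RtoC 0))).
    rewrite !Ef, Cplus_0_r; f_equal.
    + rewrite <- cexp_0; do 2 f_equal; ring.
    + rewrite cexp_polar; do 2 f_equal.
      * unfold p; rewrite <- exp_INR_mult; f_equal; simpl; ring.
      * f_equal; ring.
Qed.

Lemma sin_2PI_5_lower : 4 / 5 <= sin (2 * PI / 5).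
Proof.
  pose proof PI_RGT_0.
  apply Rle_trans with (sin (PI / 3)).
  - rewrite sin_PI3.
    assert (8 / 5 <= sqrt 3); [|lra].
    rewrite <- (sqrt_Rsqr (8 / 5)) by lra; apply sqrt_le_1_alt; unfold Rsqr; lra.
  - apply sin_incr_1; lra.
Qed.

(* The constant terms cancel, so the order p^4 of the expansion decides. *)
Lemma cubic_difference_neq_0 (x1 x3 x7 x9 : C) (u B : R) :
  u = / 10000 -> B <= 3 / 1000000 ->
  (forall k x, In (k, x) ((1, x1) :: (3, x3) :: (7, x7) :: (9, x9) :: nil) ->
     Cmod (Cminus x (Cplus (RtoC 1) (Cmult (RtoC u) (cexp (0, - (PI * k / 5)))))) <= B) ->
  Cminus (Cmult (Cmult x3 x3) x9) (Cmult x1 (Cmult x7 x7)) <> RtoC 0.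
Proof.
  intros Hu HB Hx E.
  (* Each x is written 1 + w + r = 1 + z, with [w] the explicit term of order [u] and [r] the
     truncation error. *)
  pose (w (k : R) := Cmult (RtoC u) (cexp (0, - (PI * k / 5)))).
  pose (r k x := Cminus x (Cplus (RtoC 1) (w k))).
  pose (z (x : C) := Cminus x (RtoC 1)).
  assert (Hr : forall k x, In (k, x) ((1, x1) :: (3, x3) :: (7, x7) :: (9, x9) :: nil) ->
     Cmod (r k x) <= B /\ Cmod (z x) <= 2 * u).
  { intros k x Hin; split; [now apply Hx|].
    replace (z x) with (Cplus (w k) (r k x)) by (unfold r, z; ring).
    eapply Rle_trans; [apply Cmod_triangle|].
    assert (Cmod (w k) = u).
    { unfold w; rewrite Cmod_mult, Cmod_R, Cmod_cexp; simpl Re.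
      rewrite exp_0, Rabs_pos_eq; lra. }
    specialize (Hx k x Hin); fold (w k) in Hx; fold (r k x) in Hx; lra. }
  destruct (Hr 1 x1) as [r1 z1]; [simpl; tauto|].
  destruct (Hr 3 x3) as [r3 z3]; [simpl; tauto|].
  destruct (Hr 7 x7) as [r7 z7]; [simpl; tauto|].
  destruct (Hr 9 x9) as [r9 z9]; [simpl; tauto|].
  (* The first-order part of x3^2 x9 - x1 x7^2, with each z replaced by its [w]. *)
  pose (lin := Cminus (Cplus (Cmult (RtoC 2) (w 3)) (w 9))
                      (Cplus (w 1) (Cmult (RtoC 2) (w 7)))).
  assert (Elin : Im lin = u * (2 * sin (PI / 5) - 4 * sin (2 * PI / 5))).
  { unfold lin, w, cexp; simpl.
    replace (- (PI * 3 / 5)) with (2 * PI / 5 - PI) by field.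
    replace (- (PI * 9 / 5)) with (PI / 5 - 2 * PI) by field.
    replace (- (PI * 7 / 5)) with (PI + - (2 * PI / 5) - 2 * PI) by field.
    replace (- (PI * 1 / 5)) with (- (PI / 5)) by field.
    unfold Rminus.
    rewrite !sin_plus, !cos_plus, !sin_neg, !cos_neg, exp_0, cos_2PI, sin_2PI, cos_PI, sin_PI.
    ring. }
  assert (Llin : 6 / 5 * u <= Cmod lin).
  { eapply Rle_trans; [|apply im_le_Cmod]; rewrite Elin.
    (* The sine difference is at most 2 - 4 * (4/5) = -6/5. *)
    pose proof sin_2PI_5_lower; pose proof (SIN_bound (PI / 5)).
    rewrite Rabs_left1; nra. }
  pose (a := Cplus (Cminus (Cplus (r 3 x3) (r 3 x3)) (Cplus (r 7 x7) (r 7 x7)))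
                   (Cminus (r 9 x9) (r 1 x1))).
  (* The terms of degree at least two in (1 + z s)^2 (1 + z t); [a] above gathers the linear
     contribution of the errors [r]. *)
  pose (q s t := Cplus (Cplus (Cmult (z s) (z s)) (Cplus (Cmult (z s) (z t)) (Cmult (z s) (z t))))
                       (Cmult (Cmult (z s) (z s)) (z t))).
  assert (Dec : lin = Copp (Cplus a (Cminus (q x3 x9) (q x7 x1)))).
  { transitivity (Cplus (Cminus (Cmult (Cmult x3 x3) x9) (Cmult x1 (Cmult x7 x7)))
                    (Copp (Cplus a (Cminus (q x3 x9) (q x7 x1))))).
    - unfold lin, a, q, r, z; ring.
    - rewrite E; ring. }
  assert (Tm : forall s t, Cmod (Cminus s t) <= Cmod s + Cmod t).
  { intros s t; unfold Cminus; rewrite <- (Cmod_opp t); apply Cmod_triangle. }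
  assert (Ha : Cmod a <= 6 * B).
  { unfold a; eapply Rle_trans; [apply Cmod_triangle|].
    pose proof (Tm (Cplus (r 3 x3) (r 3 x3)) (Cplus (r 7 x7) (r 7 x7))).
    pose proof (Tm (r 9 x9) (r 1 x1)).
    pose proof (Cmod_triangle (r 3 x3) (r 3 x3)).
    pose proof (Cmod_triangle (r 7 x7) (r 7 x7)); lra. }
  assert (Hq : forall s t, Cmod (z s) <= 2 * u -> Cmod (z t) <= 2 * u ->
    Cmod (q s t) <= 13 * u ^ 2).
  { intros s t Hs Ht; unfold q; eapply Rle_trans; [apply Cmod_triangle|].
    pose proof (Cmod_triangle (Cmult (z s) (z s))
      (Cplus (Cmult (z s) (z t)) (Cmult (z s) (z t)))).
    pose proof (Cmod_triangle (Cmult (z s) (z t)) (Cmult (z s) (z t))).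
    rewrite !Cmod_mult in *.
    pose proof (Cmod_ge_0 (z s)); pose proof (Cmod_ge_0 (z t)).
    assert (Cmod (z s) * Cmod (z s) <= 2 * u * (2 * u)) by (apply Rmult_le_compat; lra).
    assert (Cmod (z s) * Cmod (z t) <= 2 * u * (2 * u)) by (apply Rmult_le_compat; lra).
    assert (Cmod (z s) * Cmod (z s) * Cmod (z t) <= 2 * u * (2 * u) * (2 * u)).
    { apply Rmult_le_compat; try lra; nra. }
    subst u; lra. }
  assert (Cmod lin <= 6 * B + 26 * u ^ 2).
  { rewrite Dec, Cmod_opp; eapply Rle_trans; [apply Cmod_triangle|].
    pose proof (Tm (q x3 x9) (q x7 x1)).
    pose proof (Hq x3 x9 z3 z9); pose proof (Hq x7 x1 z7 z1); lra. }
  (* The lower bound 1.2e-4 for [lin] contradicts the upper bound 1.8e-5 + 2.6e-7. *)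
  subst u; lra.
Qed.

Lemma theta_denominator_neq_0 :
  exists tau, in_H2 tau /\
    let e k := Theta (1 / 10) (k / 10) tau in
    Cminus (Cmult (Cmult (e 3) (e 3)) (e 9)) (Cmult (e 1) (Cmult (e 7) (e 7))) <> RtoC 0.
Proof.
  pose proof PI_RGT_0 as Hpi.
  assert (Hln : 0 < ln 10) by (rewrite <- ln_1; apply ln_increasing; lra).
  (* Chosen so that p = exp (- pi y / 5) is 1/10; the error bound is then 2e-6 / 0.99, below
     3e-6. *)
  set (y := 5 * ln 10 / PI).
  assert (Hy : 0 < y) by (apply Rdiv_lt_0_compat; lra).
  exists (0, y); split; [exact Hy|]; intros e.
  set (c k := cexp (PI * y / 100, - (PI * k / 50))).
  assert (Hp : exp (- (PI * y / 5)) = / 10).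
  { replace (PI * y / 5) with (ln 10) by (unfold y; field; lra).
    rewrite exp_Ropp, exp_ln by lra; reflexivity. }
  assert (Hc : Cminus (Cmult (Cmult (Cmult (c 3) (e 3)) (Cmult (c 3) (e 3))) (Cmult (c 9) (e 9)))
    (Cmult (Cmult (c 1) (e 1)) (Cmult (Cmult (c 7) (e 7)) (Cmult (c 7) (e 7)))) <> RtoC 0).
  { apply (cubic_difference_neq_0 _ _ _ _ (/ 10000) (3 / 1000000)); [reflexivity|lra|].
    intros k x Hin.
    assert (Hx : x = Cmult (c k) (e k)).
    { simpl in Hin.
      repeat (destruct Hin as [Hin|Hin]; [injection Hin; intros; subst; reflexivity|]).
      contradiction. }
    rewrite Hx; pose proof (Theta_expansion y k Hy) as T; cbv zeta in T.
    rewrite Hp in T; replace ((/ 10) ^ 4) with (/ 10000) in T by field.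
    eapply Rle_trans; [exact T|]; lra. }
  intros E; apply Hc.
  (* Since 3 + 3 + 9 = 1 + 7 + 7, both cubic monomials carry the same normalising factor, so a zero
     of the original difference would be a zero of the normalised one. *)
  assert (E39 : Cmult (Cmult (c 3) (c 3)) (c 9) = cexp (3 * PI * y / 100, - (3 * PI / 10))).
  { unfold c; rewrite <- !cexp_plus; unfold Cplus; simpl; do 2 f_equal; field. }
  assert (E17 : Cmult (c 1) (Cmult (c 7) (c 7)) = cexp (3 * PI * y / 100, - (3 * PI / 10))).
  { unfold c; rewrite <- !cexp_plus; unfold Cplus; simpl; do 2 f_equal; field. }
  clearbody c e.
  transitivity (Cminus
    (Cmult (Cmult (Cmult (c 3) (c 3)) (c 9)) (Cmult (Cmult (e 3) (e 3)) (e 9)))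
    (Cmult (Cmult (c 1) (Cmult (c 7) (c 7))) (Cmult (e 1) (Cmult (e 7) (e 7))))); [ring|].
  rewrite E39, E17, <- (Cmult_0_r (cexp (3 * PI * y / 100, - (3 * PI / 10)))), <- E; ring.
Qed.

(** * The rational expression *)

Lemma theta5_Theta (k : nat) (tau : C) : theta5 k tau = Theta (1 / 10) (INR k / 10) tau.
Proof. unfold theta5; rewrite theta_const_Theta; f_equal; field. Qed.

(* There are four distinct k1..k4 in {1,3,5,7,9} and polynomials P, Q with
   complex coefficients such that, as functions on H^2,
     theta[1;1/5] / theta[1;3/5] = P(theta5 k1, ..., theta5 k4) / Q(...),
   i.e. Q(...) is not identically zero on H^2 and the cross-multiplied
   identity holds at every tau in H^2. *)
Theorem theorem4p1 :
  exists k1 k2 k3 k4 : nat,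
    In k1 (1 :: 3 :: 5 :: 7 :: 9 :: nil)%nat /\
    In k2 (1 :: 3 :: 5 :: 7 :: 9 :: nil)%nat /\
    In k3 (1 :: 3 :: 5 :: 7 :: 9 :: nil)%nat /\
    In k4 (1 :: 3 :: 5 :: 7 :: 9 :: nil)%nat /\
    NoDup (k1 :: k2 :: k3 :: k4 :: nil) /\
    exists P Q : poly4,
      (exists tau : C, in_H2 tau /\
         eval4 Q (theta5 k1 tau) (theta5 k2 tau) (theta5 k3 tau) (theta5 k4 tau)
           <> RtoC 0) /\
      (forall tau : C, in_H2 tau ->
         Cmult (eval4 Q (theta5 k1 tau) (theta5 k2 tau) (theta5 k3 tau) (theta5 k4 tau))
               (theta_const 1 (1 / 5) tau)
         = Cmult (eval4 P (theta5 k1 tau) (theta5 k2 tau) (theta5 k3 tau) (theta5 k4 tau))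
                 (theta_const 1 (3 / 5) tau)).
Proof.
  (* The index 5 was eliminated from the Pluecker relations. *)
  exists 1%nat, 3%nat, 7%nat, 9%nat.
  do 4 (split; [simpl; tauto|]).
  split; [repeat constructor; simpl; intuition discriminate|].
  (* Exponents refer to (e_1, e_3, e_7, e_9). The coefficients lie in the field of fifth roots of
     unity: exp (pi i / 5) = - zeta_5^3 and exp (- pi i / 5) = - zeta_5^2. *)
  exists ((cexp (0, PI / 5)%R, (2, 1, 0, 0)%nat)
          :: (Copp (cexp (0, - (PI / 5))%R), (0, 0, 1, 2)%nat) :: nil).
  exists ((RtoC 1, (0, 2, 0, 1)%nat) :: (Copp (RtoC 1), (1, 0, 2, 0)%nat) :: nil).
  assert (E : forall tau,
    theta5 1 tau = Theta (1 / 10) (1 / 10) tau /\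
    theta5 3 tau = Theta (1 / 10) (3 / 10) tau /\
    theta5 7 tau = Theta (1 / 10) (7 / 10) tau /\
    theta5 9 tau = Theta (1 / 10) (9 / 10) tau).
  { intros tau; rewrite !theta5_Theta; repeat split; f_equal; simpl; field. }
  split.
  - destruct theta_denominator_neq_0 as (tau & Htau & HQ); cbv beta zeta in HQ.
    exists tau; split; auto; intros E0; apply HQ; rewrite <- E0.
    destruct (E tau) as (-> & -> & -> & ->); clear.
    generalize (Theta (1 / 10) (1 / 10) tau) (Theta (1 / 10) (3 / 10) tau)
      (Theta (1 / 10) (7 / 10) tau) (Theta (1 / 10) (9 / 10) tau).
    intros; unfold eval4; simpl; ring.
  - intros tau Htau; pose proof (theta_relation tau Htau) as Hrel; cbv beta zeta in Hrel.
    destruct (E tau) as (-> & -> & -> & ->); rewrite !theta_const_Theta.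
    replace (1 / 5 / 2) with (1 / 10) by field.
    replace (3 / 5 / 2) with (3 / 10) by field.
    revert Hrel; clear.
    generalize (Theta (1 / 10) (1 / 10) tau) (Theta (1 / 10) (3 / 10) tau)
      (Theta (1 / 10) (7 / 10) tau) (Theta (1 / 10) (9 / 10) tau)
      (Theta (1 / 2) (1 / 10) tau) (Theta (1 / 2) (3 / 10) tau)
      (cexp (0, PI / 5)) (cexp (0, - (PI / 5))).
    intros e1 e3 e7 e9 A1 A3 l m Hrel; unfold eval4; simpl.
    match type of Hrel with ?p = ?q => transitivity p; [ring|];
      transitivity q; [exact Hrel|ring] end.
Qed.
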